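(* Let $G$ be a finite connected simple graph with $n_V$ vertices of degrees $d_1,\dots,d_{n_V}$ and $n_E$ edges, let $u\in\mathbb C$ with $u\ne1$, and let $u_*=1-\frac{n_E}{n_V}$. Consider the point $q=(1-u)^{-1}$ for the rational function $q\mapsto\zeta_G(q,u)$. (i) If $G$ is not a tree, then $q=(1-u)^{-1}$ is a pole of order exactly $n_E-n_V+1$ when $u\ne u_*$, and its order is at least $n_E-n_V+2$ if and only if $u=u_*$. (ii) If $G$ is a tree, then $q=(1-u)^{-1}$ is not a pole when $u\ne u_*$, and it is a pole if and only if $u=u_*$. (iii) In particular, if $|(L^+)^T\vec d|^2\ne n_E$, where $L^+$ is the Moore–Penrose inverse of the incidence matrix $L$ and $\vec d=(d_1,\dots,d_{n_V})^T$, then at $u=u_*$ the order of the pole at $q=(1-u)^{-1}$ is exactly $n_E-n_V+2$.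
   Context: Each edge $e$ of $G$ has a fixed orientation with source $s(e)$ and target $t(e)$. The incidence matrix $L$ is the $n_E\times n_V$ matrix with $L_{ev}=1$ if $v=t(e)$, $-1$ if $v=s(e)$, $0$ otherwise. $A$ is the adjacency matrix, $D=\mathrm{diag}(d_i)$, $Q_u=(1-u)\bigl(D-(1-u)I_{n_V}\bigr)$. The Bartholdi zeta function is defined for small $|q|,|u|$ by the Euler product $\zeta_G(q,u)=\prod_{[C]}(1-q^{|C|}u^{b(C)})^{-1}$ over rotation-equivalence classes of primitive cycles (closed walks on directed edges), $|C|$ the length, $b(C)$ the number of bumps (consecutive traversal of an edge and its reverse, counted cyclically); it equals the rational function $(1-(1-u)^2q^2)^{-(n_E-n_V)}\det(I_{n_V}-qA+q^2Q_u)^{-1}$, and $\zeta_G(q,u)$ denotes this rational function (orders of poles are taken in the variable $q$ for fixed $u$). *)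

(* Defs.v *)
From HB Require Import structures.
From mathcomp Require Import all_boot all_order all_algebra.
From mathcomp Require Import classical_sets reals.
From mathcomp Require Export complex.

Set Implicit Arguments.
Unset Strict Implicit.
Unset Printing Implicit Defensive.

Import Order.TTheory GRing.Theory Num.Theory.
Local Open Scope ring_scope.

Record sgraph := SGraph {
  vert :> finType;
  adj : rel vert;
  adj_sym : symmetric adj;
  adj_irrefl : irreflexive adj }.

Section Graph.
Variable G : sgraph.

(* The null graph is not connected. *)
Definition connected_graph : Prop :=
  (0 < #|G|)%N /\ forall x y : G, connect (@adj G) x y.

(* [ucycle] also accepts the lists [:: x; y] with x adjacent to y, which
   traverse one edge back and forth; a cycle of a simple graph has at least
   three vertices. *)
Definition acyclic_graph : Prop :=
  forall c : seq G, ucycle (@adj G) c -> (size c < 3)%N.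

Definition is_tree : Prop := connected_graph /\ acyclic_graph.

Definition edges : {set {set G}} :=
  [set E : {set G} | [exists x, exists y, adj x y && (E == [set x; y])]].

Definition nV : nat := #|G|.
Definition nE : nat := #|edges|.

Definition deg (x : G) : nat := #|[set y | adj x y]|.

(* An edge is the two-element set of its endpoints, so the condition says that
   s E and t E are its two distinct endpoints. *)
Definition is_orientation (s t : {set G} -> G) : Prop :=
  forall E, E \in edges -> [set s E; t E] = E.

(* Matrices are indexed through the enumerations of vertices and edges. *)
Definition vtx (i : 'I_nV) : G := enum_val i.
Definition edge (i : 'I_nE) : {set G} := enum_val i.

Definition incidence (K : nzRingType) (s t : {set G} -> G) : 'M[K]_(nE, nV) :=
  \matrix_(i, j)
    if vtx j == t (edge i) then 1 else if vtx j == s (edge i) then -1 else 0.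

Definition adjacency (K : nzRingType) : 'M[K]_nV :=
  \matrix_(i, j) (adj (vtx i) (vtx j))%:R.

Definition degmx (K : nzRingType) : 'M[K]_nV :=
  diag_mx (\row_i (deg (vtx i))%:R).

Definition degvec (K : nzRingType) : 'cV[K]_nV := \col_i (deg (vtx i))%:R.

Definition Qmx (K : nzRingType) (u : K) : 'M[K]_nV :=
  (1 - u) *: (degmx K - (1 - u)%:M).

(* The variable q is 'X. *)
Definition zeta_mx (K : fieldType) (u : K) : 'M[{poly K}]_nV :=
  1%:M - 'X *: map_mx polyC (adjacency K) + 'X^2 *: map_mx polyC (Qmx u).

(* The exponent nE - nV is an integer; it is -1 for a tree. *)
Definition zeta (K : fieldType) (u : K) : {fraction {poly K}} :=
  FracField.tofrac (1 - ((1 - u) ^+ 2) *: 'X^2) ^ (- (nE%:Z - nV%:Z))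
  * (FracField.tofrac (\det (zeta_mx u)))^-1.

Definition ustar (K : fieldType) : K := 1 - nE%:R / nV%:R.

End Graph.

Arguments nV : clear implicits.
Arguments nE : clear implicits.
Arguments adjacency : clear implicits.
Arguments degmx : clear implicits.
Arguments degvec : clear implicits.
Arguments Qmx G [K] u.
Arguments zeta_mx G [K] u.
Arguments zeta G [K] u.
Arguments ustar : clear implicits.

(* Multiplicity of a in the denominator minus multiplicity in the numerator:
   negative at a zero, 0 at a regular point that is not a zero. Independent of
   the representative by [pole_order_frac]; meaningless for f = 0. *)
Definition pole_order (K : fieldType) (f : {fraction {poly K}}) (a : K) : int :=
  (mup a \d_(repr f))%:Z - (mup a \n_(repr f))%:Z.

Definition is_pole (K : fieldType) (f : {fraction {poly K}}) (a : K) : Prop :=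
  0 < pole_order f a.

Definition pole_of_order (K : fieldType) (f : {fraction {poly K}}) (a : K)
  (k : int) : Prop := is_pole f a /\ pole_order f a = k.

Definition penrose (K : realFieldType) (m n : nat) (A : 'M[K]_(m, n))
    (X : 'M[K]_(n, m)) : Prop :=
  [/\ A *m X *m A = A, X *m A *m X = X,
      (A *m X)^T = A *m X & (X *m A)^T = X *m A].

Definition mpinv (K : realFieldType) (m n : nat) (A : 'M[K]_(m, n)) :
  'M[K]_(n, m) := xget 0 (penrose A).

(* Squared Euclidean norm; the library norm on matrices is the sup norm. *)
Definition normsq (K : realFieldType) (m : nat) (v : 'cV[K]_m) : K :=
  \sum_i v i 0 ^+ 2.

Lemma tofrac_repr (K : fieldType) (f : {fraction {poly K}}) :
  f * FracField.tofrac \d_(repr f) = FracField.tofrac \n_(repr f).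
Proof.
rewrite -{1}(reprK f); move: (repr f) => x; unlock FracField.tofrac.
rewrite -[LHS]FracField.pi_mul; apply/eqmodP; rewrite /= FracField.equivfE.
rewrite !numden_Ratio ?(oner_eq0, mulf_neq0, denom_ratioP) //.
by rewrite !mulr1 mulrC.
Qed.

Lemma pole_order_frac (K : fieldType) (p q : {poly K}) (a : K) :
  p != 0 -> q != 0 ->
  pole_order (FracField.tofrac p / FracField.tofrac q) a
    = (mup a q)%:Z - (mup a p)%:Z.
Proof.
move=> p0 q0; rewrite /pole_order.
set f := _ / _; have := tofrac_repr f.
have d0 := denom_ratioP (repr f).
set d := \d_(repr f) in d0 *; set n := \n_(repr f).
have qF : FracField.tofrac q != 0 by rewrite tofrac_eq0.
move/(congr1 (fun x => x * FracField.tofrac q)).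
rewrite /f mulrAC divfK // -!tofracM => /eqP; rewrite tofrac_eq => /eqP e.
have n0 : n != 0.
  by apply: contraNneq (mulf_neq0 p0 d0) => n0; rewrite e n0 mul0r.
have := congr1 (mup a) e; rewrite !mupM // => h.
apply/eqP; rewrite subr_eq addrAC eq_sym subr_eq -!PoszD eqz_nat.
by rewrite (addnC (mup a q)) (addnC (mup a d)) h.
Qed.

Lemma zeta_neq0 (G : sgraph) (K : fieldType) (u : K) : zeta G u != 0.
Proof.
rewrite mulf_neq0 ?invr_neq0 ?expfz_neq0 ?tofrac_eq0 //.
  apply/eqP => /(congr1 (fun p => p.[0])) /eqP.
  by rewrite !hornerE /= ?expr0n /= ?mulr0 ?subr0 oner_eq0.
apply/eqP => /(congr1 (horner_eval 0)); rewrite rmorph0 -det_map_mx.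
suff -> : map_mx (horner_eval 0) (zeta_mx G u) = 1%:M.
  by rewrite det1 => /eqP; rewrite oner_eq0.
apply/matrixP => i j; rewrite !mxE /horner_eval !hornerE.
by rewrite ?expr0n /= ?mul0r ?subr0 ?addr0 hornerMn hornerC.
Qed.

Section MoorePenrose.
Variable K : realFieldType.

Lemma gram_unit m n (B : 'M[K]_(m, n)) : row_free B -> B *m B^T \in unitmx.
Proof.
move=> fB; rewrite -row_free_unit; apply: inj_row_free => v v0.
apply: (row_free_inj fB); rewrite mul0mx.
set w := v *m B.
have : (w *m w^T) 0 0 = 0.
  by rewrite /w trmx_mul mulmxA -(mulmxA v) v0 mul0mx mxE.
move: w => {v v0} w; rewrite mxE => /eqP; rewrite psumr_eq0 => [/allP h|j _]; last first.
  by rewrite mxE -expr2 sqr_ge0.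
apply/rowP => j; have := h j (mem_index_enum _).
by rewrite !mxE -expr2 sqrf_eq0 => /eqP.
Qed.

Lemma penrose_factor m n r (F : 'M[K]_(m, r)) (H : 'M[K]_(r, n)) :
  row_full F -> row_free H -> exists X, penrose (F *m H) X.
Proof.
move=> fF fH.
have uH : H *m H^T \in unitmx by apply/gram_unit.
have uF : F^T *m F \in unitmx.
  have := @gram_unit _ _ F^T; rewrite trmxK; apply.
  by rewrite /row_free mxrank_tr.
set P := invmx (H *m H^T); set Q := invmx (F^T *m F).
have sP : P^T = P by rewrite trmx_inv trmx_mul trmxK.
have sQ : Q^T = Q by rewrite trmx_inv trmx_mul trmxK.
pose X := H^T *m P *m (Q *m F^T).
have AX : F *m H *m X = F *m Q *m F^T.
  rewrite /X -!mulmxA; congr (F *m _).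
  by rewrite (mulmxA H) (mulmxA _ P) mulmxV // mul1mx.
have XA : X *m (F *m H) = H^T *m P *m H.
  rewrite /X -!mulmxA; congr (_ *m (_ *m _)).
  by rewrite (mulmxA F^T) (mulmxA Q) mulVmx // mul1mx.
exists X; split.
- by rewrite AX -!mulmxA (mulmxA F^T) (mulmxA Q) mulVmx // mul1mx.
- rewrite XA /X -!mulmxA (mulmxA H) (mulmxA P (H *m H^T)) mulVmx //.
  by rewrite mul1mx.
- by rewrite AX !trmx_mul trmxK sQ mulmxA.
- by rewrite XA !trmx_mul trmxK sP mulmxA.
Qed.

Lemma penrose_exists m n (A : 'M[K]_(m, n)) : exists X, penrose A X.
Proof.
have := penrose_factor (col_base_full A) (row_base_free A).
by rewrite mulmx_base.
Qed.

Lemma penrose_unique m n (A : 'M[K]_(m, n)) X Y :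
  penrose A X -> penrose A Y -> X = Y.
Proof.
move=> [x1 x2 x3 x4] [y1 y2 y3 y4].
have e1 : A *m X = A *m Y.
  rewrite -x3 -{1}y1 -(mulmxA (A *m Y)) trmx_mul x3 y3.
  by rewrite mulmxA x1.
have e2 : X *m A = Y *m A.
  rewrite -x4 -{1}y1 -(mulmxA A) mulmxA trmx_mul x4 y4.
  by rewrite -mulmxA (mulmxA A) x1.
by rewrite -x2 e2 -mulmxA e1 mulmxA y2.
Qed.

Lemma mpinvP m n (A : 'M[K]_(m, n)) : penrose A (mpinv A).
Proof. by apply: xgetPex; exact: penrose_exists. Qed.

End MoorePenrose.

(* Main.v *)
(* Put w = 1 - u, let Lap = D - A = L^T L be the Laplacian and E = q - 1/w.
   Then w (I - q A + q^2 Q_u) = Lap + w (Lap + D - 2 w) E + w^2 (D - w) E^2.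
   Since G is connected, ker Lap is spanned by the all-ones vector 1 and
   adj Lap = kap J with kap <> 0 and J the all-ones matrix.  If M(q) denotes the
   matrix above and M z = E^k h with z = 1 + O(E), then adj(M) M = det(M) I
   shows that the order of vanishing of det M at q = 1/w is k when the entries of
   h(1/w) do not sum to 0, and exceeds k otherwise.  For z = 1 and k = 1 the sum
   is 2 w (n_E - w n_V).  When it vanishes, z = 1 - w E g with
   g = L^+ (L^+)^T d gives k = 2 and the sum w^2 (n_E - |(L^+)^T d|^2).
   Trees are singled out by the rank of L: it is n_V - 1 for a connected graph,
   and equals n_E exactly when the graph is acyclic. *)

Require Import Defs.
From HB Require Import structures.
From mathcomp Require Import all_boot all_order all_algebra.
From mathcomp Require Import reals complex.
From mathcomp Require Import ring zify.

Set Implicit Arguments.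
Unset Strict Implicit.
Unset Printing Implicit Defensive.

Import Order.TTheory GRing.Theory Num.Theory.
Local Open Scope ring_scope.

(** * Order of vanishing of the determinant of a polynomial matrix *)

Section DetOrder.
Variables (K : fieldType) (n : nat) (a kap : K).
Implicit Types (M : 'M[{poly K}]_n) (z h : 'cV[{poly K}]_n).

(* Cramer: [\adj M *m (M *m z) = \det M *: z]. *)
Lemma det_mul_kernel_vector M z h k j :
  M *m z = ('X - a%:P) ^+ k *: h ->
  \adj (map_mx (horner_eval a) M) = const_mx kap ->
  exists2 r, \det M * z j 0 = ('X - a%:P) ^+ k * r
           & r.[a] = kap * \sum_i (h i 0).[a].
Proof.
move=> Mz adjM; exists ((\adj M *m h) j 0).
  have /matrixP/(_ j 0) := congr1 (mulmx (\adj M)) Mz.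
  by rewrite mulmxA mul_adj_mx mul_scalar_mx -scalemxAr !mxE.
rewrite !mxE -[LHS]/(horner_eval a _) rmorph_sum mulr_sumr.
apply: eq_bigr => i _; rewrite rmorphM /=; congr (_ * _).
have /matrixP/(_ j i) := adjM; rewrite -map_mx_adj [in RHS]mxE => <-.
by rewrite [in RHS]mxE.
Qed.

(** Multiplying by [z j 0], which does not vanish at [a], keeps the multiplicity of [\det M], and
    the remaining factor [r] is nonzero at [a]. *)
Lemma mup_det_eq M z h k j :
  M *m z = ('X - a%:P) ^+ k *: h ->
  \adj (map_mx (horner_eval a) M) = const_mx kap -> kap != 0 ->
  (z j 0).[a] != 0 -> \sum_i (h i 0).[a] != 0 -> mup a (\det M) = k.
Proof.
move=> Mz adjM kap0 za ha.
have [r rE ra] := det_mul_kernel_vector j Mz adjM.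
rewrite -(@mupMl _ a _ (z j 0)) ?rootE // rE mupMl ?rootE ?ra ?mulf_neq0 //.
by rewrite mup_XsubCX eqxx.
Qed.

(** Here [r] vanishes at [a] and supplies one more factor ['X - a%:P]. *)
Lemma mup_det_gt M z h k j :
  M *m z = ('X - a%:P) ^+ k *: h ->
  \adj (map_mx (horner_eval a) M) = const_mx kap -> \det M != 0 ->
  (z j 0).[a] != 0 -> \sum_i (h i 0).[a] = 0 -> (k < mup a (\det M))%N.
Proof.
move=> Mz adjM detM za ha.
have [r rE ra] := det_mul_kernel_vector j Mz adjM.
have z0 : z j 0 != 0 by apply: contraNneq za => ->; rewrite horner0.
rewrite -(@mupMl _ a _ (z j 0)) ?rootE // mup_geq ?mulf_neq0 // rE exprSr.
by rewrite dvdp_mul // dvdp_XsubCl rootE ra ha mulr0.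
Qed.

Variables (A B C : 'M[K]_n).
Let one := const_mx 1 : 'cV[K]_n.
Let E : {poly K} := 'X - a%:P.
Let M := map_mx polyC A + E *: map_mx polyC B + E ^+ 2 *: map_mx polyC C.

Hypothesis A1 : A *m one = 0.
Hypothesis adjA : \adj A = const_mx kap.
Hypothesis kap0 : kap != 0.
Hypothesis n_gt0 : (0 < n)%N.

Lemma map_horner_polyC m p (N : 'M[K]_(m, p)) :
  map_mx (horner_eval a) (map_mx polyC N) = N.
Proof. by apply/matrixP => i j; rewrite !mxE /horner_eval hornerC. Qed.

Let Ea : horner_eval a E = 0.
Proof. by rewrite /horner_eval /E !hornerE subrr. Qed.

Let adjM : \adj (map_mx (horner_eval a) M) = const_mx kap.
Proof.
rewrite /M !map_mxD !map_mxZ !map_horner_polyC rmorphXn /= Ea expr0n /=.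
by rewrite !scale0r !addr0.
Qed.

Let M1 : M *m map_mx polyC one
  = E ^+ 1 *: (map_mx polyC (B *m one) + E *: map_mx polyC (C *m one)).
Proof.
rewrite /M !mulmxDl -!scalemxAl -!map_mxM A1 map_mx0 add0r.
by rewrite expr1 scalerDr scalerA -expr2.
Qed.

Let sum_horner (b c : 'cV[K]_n) :
  \sum_i ((map_mx polyC b + E *: map_mx polyC c) i 0).[a] = \sum_i b i 0.
Proof.
apply: eq_bigr => i _; rewrite !mxE hornerD hornerM !hornerC.
by rewrite -[E.[a]]/(horner_eval a E) Ea mul0r addr0.
Qed.

Let one_horner j : ((map_mx polyC one) j 0).[a] != 0.
Proof. by rewrite !mxE hornerC oner_eq0. Qed.

Lemma mup_det_perturb1 :
  \sum_i (B *m one) i 0 != 0 -> mup a (\det M) = 1%N.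
Proof.
move=> b0; apply: (mup_det_eq M1 adjM kap0 (one_horner (Ordinal n_gt0))).
by rewrite sum_horner.
Qed.

Lemma mup_det_perturb_gt1 :
  \det M != 0 -> \sum_i (B *m one) i 0 = 0 -> (1 < mup a (\det M))%N.
Proof.
move=> d0 b0; apply: (mup_det_gt M1 adjM d0 (one_horner (Ordinal n_gt0))).
by rewrite sum_horner.
Qed.

(* [one - E *: g] is the kernel vector of [A] corrected to first order. *)
Lemma mup_det_perturb2 (g : 'cV[K]_n) :
  A *m g = B *m one -> \sum_i (C *m one - B *m g) i 0 != 0 ->
  mup a (\det M) = 2%N.
Proof.
move=> Ag f0.
(* The terms of order 0 and 1 in [E] cancel by [A1] and [Ag]. *)
have Mz : M *m (map_mx polyC one - E *: map_mx polyC g)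
  = E ^+ 2 *: (map_mx polyC (C *m one - B *m g)
               + E *: map_mx polyC (- (C *m g))).
  rewrite mulmxBr M1 -scalemxAr /M !mulmxDl -!scalemxAl -!map_mxM Ag.
  rewrite map_mxB map_mxN; move: (map_mx _ _) (map_mx _ _) => x y.
  move: (map_mx _ _) (map_mx _ _) => v t.
  by apply/matrixP => i j; rewrite !mxE; ring.
apply: (mup_det_eq (j := Ordinal n_gt0) Mz adjM kap0); rewrite ?sum_horner //.
rewrite !mxE hornerD hornerN hornerM !hornerC.
by rewrite -[E.[a]]/(horner_eval a E) Ea mul0r subr0 oner_eq0.
Qed.

End DetOrder.

(** * Incidence matrix and Laplacian *)

Lemma normsq_ge0 (K : realFieldType) m (v : 'cV[K]_m) : 0 <= normsq v.
Proof. by apply: sumr_ge0 => i _; apply: sqr_ge0. Qed.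

Lemma normsq_eq0 (K : realFieldType) m (v : 'cV[K]_m) : normsq v = 0 -> v = 0.
Proof.
move/eqP; rewrite psumr_eq0 => [/allP h|i _]; last exact: sqr_ge0.
apply/matrixP => i j; have := h i (mem_index_enum _).
by rewrite ord1 mxE sqrf_eq0 => /eqP.
Qed.

Lemma normsqE (K : realFieldType) m (v : 'cV[K]_m) : normsq v = (v^T *m v) 0 0.
Proof. by rewrite mxE; apply: eq_bigr => i _; rewrite mxE expr2. Qed.

Lemma eq_set2 (T : finType) (a b c d : T) : [set a; b] = [set c; d] ->
  (a = c /\ b = d) \/ (a = d /\ b = c).
Proof.
move=> e.
have /set2P ha : a \in [set c; d] by rewrite -e set21.
have /set2P hb : b \in [set c; d] by rewrite -e set22.
have /set2P hc : c \in [set a; b] by rewrite e set21.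
have /set2P hd : d \in [set a; b] by rewrite e set22.
by case: ha hb hc hd => -> [] -> [] h1 [] h2; subst; auto.
Qed.

Definition laplacian (G : sgraph) (K : nzRingType) : 'M[K]_(nV G) :=
  degmx G K - adjacency G K.

Arguments laplacian : clear implicits.

Lemma laplacian_tr (G : sgraph) (K : nzRingType) :
  (laplacian G K)^T = laplacian G K.
Proof.
rewrite /laplacian linearB /= tr_diag_mx; congr (_ - _).
by apply/matrixP => i j; rewrite !mxE adj_sym.
Qed.

Lemma map_laplacian (G : sgraph) (K K' : nzRingType) (f : {rmorphism K -> K'}) :
  map_mx f (laplacian G K) = laplacian G K'.
Proof.
by apply/matrixP => i j; rewrite !mxE rmorphB rmorphMn !rmorph_nat.
Qed.

Lemma map_degvec (G : sgraph) (K K' : nzRingType) (f : {rmorphism K -> K'}) :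
  map_mx f (degvec G K) = degvec G K'.
Proof. by apply/matrixP => i j; rewrite !mxE rmorph_nat. Qed.

(** * Oriented edges, kernel and rank of the incidence matrix *)

Section Edges.
Variable G : sgraph.

Lemma mem_edges (x y : G) : ([set x; y] \in edges G) = adj x y.
Proof.
rewrite inE; apply/existsP/idP => [[a /existsP[b /andP[ab /eqP]]]|xy].
  by case/eq_set2 => -[-> ->] //; rewrite adj_sym.
by exists x; apply/existsP; exists y; rewrite xy eqxx.
Qed.

Lemma edge_surj E : E \in edges G -> exists i : 'I_(nE G), edge i = E.
Proof. by move=> hE; exists (enum_rank_in hE E); apply: enum_rankK_in. Qed.

Variables s t : {set G} -> G.
Hypothesis st : is_orientation s t.

Lemma orientation_adj E : E \in edges G -> adj (s E) (t E).
Proof. by move=> hE; rewrite -mem_edges st. Qed.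

Lemma orientation_neq E : E \in edges G -> (s E == t E) = false.
Proof.
by move=> /orientation_adj; apply: contraTF => /eqP->; rewrite adj_irrefl.
Qed.

Lemma orientation_edge (x y : G) : adj x y ->
  exists i : 'I_(nE G), edge i = [set x; y] /\
    ((s (edge i) = x /\ t (edge i) = y) \/ (s (edge i) = y /\ t (edge i) = x)).
Proof.
rewrite -mem_edges => hE; have [i iE] := edge_surj hE; exists i; split=> //.
by apply: eq_set2; rewrite iE st.
Qed.

Variable K : realFieldType.
Let L : 'M[K]_(nE G, nV G) := incidence K s t.

(** The nested conditional is a difference of indicators because the two ends of an edge are
    distinct. *)
Lemma incidenceE i j :
  L i j = (vtx j == t (edge i))%:R - (vtx j == s (edge i))%:R.
Proof.
rewrite mxE; have [->|_] := eqVneq (vtx j) (t (edge i)).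
  by rewrite eq_sym orientation_neq ?subr0 ?enum_valP.
by case: eqP => _; rewrite sub0r ?oppr0.
Qed.

(** Reads a vector indexed by ordinals as a function on vertices, so that it can be followed along
    paths. *)
Definition at_vtx (v : 'cV[K]_(nV G)) (x : G) : K := v (enum_rank x) 0.

Lemma sum_vtx (F : G -> K) : \sum_(j < nV G) F (vtx j) = \sum_x F x.
Proof.
rewrite (reindex_onto (@vtx G) (fun x => enum_rank x)) /=; last first.
  by move=> x _; rewrite /vtx enum_rankK.
by apply: eq_bigl => j; rewrite /vtx enum_valK eqxx.
Qed.

Lemma at_vtxE (v : 'cV[K]_(nV G)) (j : 'I_(nV G)) : v j 0 = at_vtx v (vtx j).
Proof. by rewrite /at_vtx /vtx enum_valK. Qed.

Lemma incidence_mul (v : 'cV[K]_(nV G)) i :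
  (L *m v) i 0 = at_vtx v (t (edge i)) - at_vtx v (s (edge i)).
Proof.
rewrite mxE; under eq_bigr => j _ do rewrite incidenceE at_vtxE mulrBl.
have pick x : \sum_(j < nV G) (vtx j == x)%:R * at_vtx v (vtx j) = at_vtx v x.
  rewrite (sum_vtx (fun y => (y == x)%:R * at_vtx v y)) (bigD1 x) //= eqxx.
  by rewrite mul1r big1 ?addr0 // => y /negbTE->; rewrite mul0r.
by rewrite sumrB !pick.
Qed.

Lemma incidence_const : L *m const_mx 1 = 0 :> 'cV_(nE G).
Proof.
by apply/matrixP => i j; rewrite ord1 incidence_mul /at_vtx !mxE subrr.
Qed.

Lemma incidence_ker (v : 'cV[K]_(nV G)) : connected_graph G -> L *m v = 0 ->
  forall x y, at_vtx v x = at_vtx v y.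
Proof.
move=> [_ conn] Lv0 x y.
have av x1 y1 : adj x1 y1 -> at_vtx v x1 = at_vtx v y1.
  move=> /orientation_edge[i [_ h]].
  have /matrixP/(_ i 0) := Lv0; rewrite incidence_mul mxE => /subr0_eq.
  by case: h => -[-> ->].
have /connectP[p + ->] := conn x y.
by elim: p x => //= z p IH x /andP[xz /IH <-]; apply: av.
Qed.

Lemma incidence_ker_const (v : 'cV[K]_(nV G)) (j0 : 'I_(nV G)) :
  connected_graph G -> L *m v = 0 -> v = const_mx (v j0 0).
Proof.
move=> conn Lv; apply/matrixP => i j; rewrite ord1 mxE !at_vtxE.
exact: incidence_ker.
Qed.

(** Rank-nullity: the kernel is the line of constant vectors. [kermx] is a left kernel, hence the
    transpose. *)
Lemma rank_incidence : connected_graph G -> (\rank L).+1 = nV G.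
Proof.
move=> conn; have [n0 _] := conn.
have : \rank (kermx L^T) = 1%N.
  have -> : \rank (kermx L^T) = \rank (const_mx 1 : 'rV[K]_(nV G)).
    apply: eqmx_rank; apply/andP; split.
      apply/row_subP => i.
      pose v := (row i (kermx L^T))^T.
      have Lv : L *m v = 0.
        by rewrite -[LHS]trmxK trmx_mul trmxK -row_mul mulmx_ker row0 trmx0.
      have vE := incidence_ker_const (Ordinal n0) conn Lv.
      have -> : row i (kermx L^T) = v (Ordinal n0) 0 *: const_mx 1.
        rewrite -[LHS]trmxK -/v vE.
        by apply/matrixP => a b; rewrite !mxE mulr1.
      exact: scalemx_sub.
    apply/sub_kermxP; rewrite -[const_mx 1]trmxK -trmx_mul trmx_const.
    by rewrite incidence_const trmx0.
  rewrite rank_rV; case: eqP => // /matrixP/(_ 0 (Ordinal n0)).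
  by rewrite !mxE => /eqP; rewrite oner_eq0.
by rewrite mxrank_ker mxrank_tr; have := rank_leq_col L; lia.
Qed.

(* The row of an edge e is independent of the others: [L] maps the indicator of
   the component of the source of e in G - e to a vector supported on e. *)
Lemma acyclic_row_free : acyclic_graph G -> row_free L.
Proof.
move=> acyc; apply: inj_row_free => y yL; apply/rowP => i; rewrite mxE.
pose x := s (edge i); pose z := t (edge i).
have hi : edge i \in edges G by apply: enum_valP.
have xz : adj x z by apply: orientation_adj.
pose e := [rel a b : G | adj a b && ([set a; b] != edge i)].
have e_sym : symmetric e by move=> a b; rewrite /e /= adj_sym setUC.
(* A simple path from [x] to [z] avoiding edge [i] would close up through that edge. Acyclicity
   leaves length at most one: length zero would be a loop, length one the deleted edge. *)
have zN : ~~ connect e x z.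
  apply/negP => /connectP[p0 /shortenP[p pp up _] zE].
  have cyc : ucycle (@adj G) (x :: p).
    rewrite /ucycle up andbT /= rcons_path -zE [adj z x]adj_sym xz andbT.
    by apply: sub_path pp => a b /andP[].
  have := acyc _ cyc; case: p pp zE {up cyc} => [|a [|b p]] //= pp zE _.
    by move: xz; rewrite zE adj_irrefl.
  by move: pp; rewrite -zE andbT => /andP[_]; rewrite /x /z st ?eqxx.
pose v : 'cV[K]_(nV G) := \col_j (connect e x (vtx j))%:R.
have vE a : at_vtx v a = (connect e x a)%:R.
  by rewrite /at_vtx mxE /vtx enum_rankK.
have Lv : L *m v = - delta_mx i 0.
  apply/matrixP => k j; rewrite ord1 incidence_mul !vE !mxE eqxx andbT.
  have [->|ki] := eqVneq k i.
    by rewrite -/z -/x (negbTE zN) connect0 sub0r.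
  have hk : edge k \in edges G by apply: enum_valP.
  have : e (s (edge k)) (t (edge k)).
    rewrite /= orientation_adj //= st //; apply: contra ki => /eqP.
    by move/enum_val_inj/eqP.
  rewrite oppr0 => ek; apply/eqP; rewrite subr_eq0; apply/eqP.
  congr (_%:R : K); congr nat_of_bool; apply/idP/idP => h.
    by apply: (connect_trans h); apply: connect1; rewrite e_sym.
  by apply: (connect_trans h); apply: connect1.
(* Pairing [y *m L = 0] with [v] isolates entry [i] of [y], up to sign. *)
have /matrixP/(_ 0 0) : y *m (L *m v) = 0 by rewrite mulmxA yL mul0mx.
by rewrite Lv mulmxN -colE !mxE => /eqP; rewrite oppr_eq0 => /eqP.
Qed.

(* If [L *m v] is supported on the closing edge of a cycle, then [v] is constant
   along the rest of the cycle, hence also across that edge. *)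
Lemma row_free_acyclic : row_free L -> acyclic_graph G.
Proof.
case/row_freeP=> B LB [|x [|y [|z p]]] // /andP[cyc].
rewrite [uniq _]/= !inE !negb_or.
case/and3P=> /and3P[xy xz xp] /andP[yz yp] /andP[zp up].
exfalso; set l := last z p.
move: cyc; rewrite /cycle rcons_path => /andP[/= /and3P[axy ayz azp] alx].
have [i [iE ist]] := orientation_edge alx.
(* A column of the right inverse is mapped by [L] to the indicator of the closing edge. *)
pose v := col i B.
have Lv : L *m v = delta_mx i 0.
  by rewrite /v colE mulmxA LB mul1mx.
have step a b : adj a b -> [set a; b] != edge i -> at_vtx v a = at_vtx v b.
  move=> /orientation_edge[k [kE kst]] ki.
  have /matrixP/(_ k 0) := Lv; rewrite incidence_mul mxE.
  have /negbTE-> : k != i by apply: contraNneq ki => <-; rewrite kE.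
  by move/subr0_eq; case: kst => -[-> ->].
have lz : l \in z :: p by apply: mem_last.
have lx : l != x by apply: contraTneq lz => ->; rewrite inE negb_or xz.
have ly : l != y by apply: contraTneq lz => ->; rewrite inE negb_or yz.
(* The closing edge joins [l] to [x], and [l] differs from [y] since the cycle has at least three
   vertices. *)
have vxy : at_vtx v x = at_vtx v y.
  apply: step => //; rewrite iE; apply/eqP => /eq_set2[] [e1 e2].
    by rewrite /l -e1 eqxx in lx.
  by rewrite /l -e2 eqxx in ly.
have xN a b : a != x -> b != x -> [set a; b] != edge i.
  move=> ax bx; rewrite iE; apply/eqP => /eq_set2[] [e1 e2].
    by rewrite e2 eqxx in bx.
  by rewrite e1 eqxx in ax.
have vyz : at_vtx v y = at_vtx v z.
  by apply: step => //; apply: xN; rewrite eq_sym.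
have vzl : at_vtx v z = at_vtx v l.
  rewrite /l; elim: p z azp xz xp {ayz yz yp zp up alx iE l lz lx ly vyz ist Lv}.
    by [].
  move=> c p IH z /= /andP[zc cp] xz; rewrite inE negb_or => /andP[xc xp].
  by rewrite -(IH c) //; apply: step => //; apply: xN; rewrite eq_sym.
have /matrixP/(_ i 0) := Lv; rewrite incidence_mul mxE !eqxx /= => /eqP.
by case: ist => -[-> ->]; rewrite -/l vxy vyz vzl subrr eq_sym oner_eq0.
Qed.

(** * The Laplacian as the Gram matrix of [L]: kernel, adjugate and trace *)

Lemma gram_incidence : L^T *m L = laplacian G K.
Proof.
apply/matrixP => a b; rewrite !mxE.
set x := vtx a; set y := vtx b.
pose f z E : K := (z == t E)%:R - (z == s E)%:R.
transitivity (\sum_(E in edges G) f x E * f y E).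
  by rewrite [RHS]big_enum_val; apply: eq_bigr => i _; rewrite mxE !incidenceE.
(* Off the diagonal only the edge joining [x] and [y] contributes, with opposite signs at its
   ends. *)
have [ab|ab] := eqVneq a b; last first.
  have xy : x != y by apply: contra ab => /eqP/enum_val_inj->.
  have fE E : E \in edges G -> f x E * f y E = - (E == [set x; y])%:R.
    move=> hE; have := orientation_neq hE; rewrite /f.
    have [e|ne] := eqVneq E [set x; y].
      have /eq_set2 : [set s E; t E] = [set x; y] by rewrite st.
      case=> -[-> ->]; rewrite !eqxx ?[y == x]eq_sym ?(negbTE xy) => _.
        by rewrite sub0r subr0 mulN1r.
      by rewrite sub0r subr0 mul1r.
    have h1 : (x == t E) && (y == s E) = false.
      apply: contraNF ne => /andP[/eqP-> /eqP->].
      by rewrite setUC st.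
    have h2 : (x == s E) && (y == t E) = false.
      by apply: contraNF ne => /andP[/eqP-> /eqP->]; rewrite st.
    have h3 c : (x == c) && (y == c) = false.
      by apply: contraNF xy => /andP[/eqP-> /eqP->].
    by rewrite mulrBl !mulrBr -!natrM !mulnb h1 h2 !h3 !subr0 oppr0.
  rewrite (eq_bigr _ fE) sumrN mulr0n sub0r; congr (- _).
  rewrite -mem_edges; have [h|h] := boolP (_ \in _).
    by rewrite (bigD1 _ h) /= eqxx big1 ?addr0 // => E /andP[_ /negbTE->].
  by rewrite big1 // => E hE; case: eqP h => // <-; rewrite hE.
(* On the diagonal each edge at [x] contributes 1, and these edges correspond to the neighbours of
   [x]. *)
rewrite /y -ab -/x adj_irrefl subr0 mulr1n.
have fE E : E \in edges G -> f x E * f x E = (x \in E)%:R.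
  move=> hE; have := orientation_neq hE; rewrite /f.
  have -> : (x \in E) = (x == s E) || (x == t E) by rewrite -{1}(st hE) !inE.
  have [->|_] := eqVneq x (s E); first by move=> ->; rewrite sub0r mulrNN mulr1.
  by case: (x == t E) => _; rewrite subr0 ?mulr1 ?mulr0.
rewrite (eq_bigr _ fE) -natr_sum; congr (_%:R).
rewrite -big_mkcondr /= sum1dep_card.
have -> : [set E in edges G | x \in E]
    = [set [set x; z] | z in [set z | adj x z]].
  apply/setP => E; rewrite inE; apply/andP/imsetP => [[hE]|[z]].
    rewrite -{1}(st hE) !inE => /orP[]/eqP->.
      by exists (t E); rewrite ?inE ?orientation_adj ?st.
    by exists (s E); rewrite ?inE 1?adj_sym ?orientation_adj // setUC st.
  by rewrite inE => xz ->; rewrite mem_edges xz set21.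
rewrite card_in_imset // => z1 z2 _ _ /eq_set2[[]|[-> ->]] //.
Qed.

Lemma gram_incidence_ker (v : 'cV[K]_(nV G)) : L^T *m L *m v = 0 -> L *m v = 0.
Proof.
move=> h; apply: normsq_eq0.
by rewrite normsqE trmx_mul -mulmxA (mulmxA L^T) h mulmx0 mxE.
Qed.

(* The value [kap] is the number of spanning trees; it is nonzero because it is
   the determinant of the Laplacian with 1 added to a diagonal entry, which is
   positive definite. *)
Lemma adj_gram_incidence : connected_graph G ->
  exists2 kap, kap != 0 & \adj (L^T *m L) = const_mx kap.
Proof.
move=> conn; have [n0 _] := conn; pose i0 : 'I_(nV G) := Ordinal n0.
set A := L^T *m L.
have detA : \det A = 0.
  apply/eqP; rewrite -det_tr; apply/det0P; exists (const_mx 1 : 'rV_(nV G)).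
    apply/eqP => /matrixP/(_ 0 i0); rewrite !mxE => /eqP.
    by rewrite oner_eq0.
  rewrite -[LHS]trmxK trmx_mul trmxK trmx_const -mulmxA incidence_const.
  by rewrite mulmx0 trmx0.
(* [A *m \adj A] is zero, so the columns of the adjugate lie in the kernel and are constant; by
   symmetry all entries agree. *)
have const_col i j : (\adj A) i j = (\adj A) i0 j.
  have : A *m col j (\adj A) = 0.
    by rewrite colE mulmxA mul_mx_adj detA raddf0 mul0mx.
  move/gram_incidence_ker/(incidence_ker_const i0 conn)/matrixP/(_ i 0).
  by rewrite !mxE.
have symA : (\adj A)^T = \adj A by rewrite trmx_adj trmx_mul trmxK.
exists ((\adj A) i0 i0); last first.
  apply/matrixP => i j; rewrite const_col -[in LHS]symA mxE const_col.
  by rewrite [RHS]mxE.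
pose A1 := A + delta_mx i0 i0.
have detA1 : \det A1 = (\adj A) i0 i0.
  rewrite (expand_det_row _ i0) [RHS]mxE.
  (* The modified entry lies in the row of expansion, which these cofactors omit. *)
  have cof j : cofactor A1 i0 j = cofactor A i0 j.
    rewrite /cofactor; congr (_ * \det _); apply/matrixP => a b; rewrite !mxE.
    by rewrite eq_sym (negbTE (neq_lift _ _)) addr0.
  under eq_bigr => j _ do rewrite cof mxE mulrDl.
  rewrite big_split /= -expand_det_row detA add0r (bigD1 i0) //= mxE !eqxx.
  by rewrite mul1r big1 ?addr0 // => j ji; rewrite mxE (negbTE ji) andbF mul0r.
rewrite -detA1; apply/det0P => -[v v0 vA].
(* For a null vector both squares vanish: the first makes it constant, the second zero at [i0]. *)
have : (v *m A1 *m v^T) 0 0 = normsq (L *m v^T) + v 0 i0 ^+ 2.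
  rewrite normsqE mulmxDr mulmxDl [LHS]mxE; congr (_ + _).
    by rewrite trmx_mul trmxK !mulmxA.
  rewrite -(mul_delta_mx (0 : 'I_1)) mulmxA -colE -mulmxA -rowE !mxE big_ord1.
  by rewrite !mxE expr2.
rewrite vA mul0mx mxE => /esym/eqP.
rewrite paddr_eq0 ?normsq_ge0 ?sqr_ge0 // => /andP[/eqP/normsq_eq0 Lv].
rewrite sqrf_eq0 => /eqP vi0; case/eqP: v0.
rewrite -[v]trmxK (incidence_ker_const i0 conn Lv) mxE vi0.
by apply/matrixP => a b; rewrite !mxE.
Qed.

(** Handshake by traces: each row of [L] has squared norm 2, while the diagonal of the Laplacian
    holds the degrees. *)
Lemma sum_deg : \sum_(j < nV G) (deg (vtx j))%:R = (2 * nE G)%:R :> K.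
Proof.
have <- : \tr (L *m L^T) = (2 * nE G)%:R.
  rewrite /mxtrace (eq_bigr (fun=> 2%:R)) => [|i _].
    by rewrite sumr_const card_ord natrM mulr_natr.
  have hi : edge i \in edges G by apply: enum_valP.
  transitivity ((L *m col i L^T) i 0).
    by rewrite colE mulmxA -colE [RHS]mxE.
  rewrite incidence_mul /at_vtx !mxE /vtx !enum_rankK !eqxx.
  by rewrite orientation_neq // opprK.
rewrite mxtrace_mulC gram_incidence /mxtrace; apply: eq_bigr => i _.
by rewrite !mxE eqxx adj_irrefl subr0 mulr1n.
Qed.

(** * The pseudoinverse of [L] and the first-order corrector [g] *)

Section Pseudoinverse.
Hypothesis conn : connected_graph G.
Let X : 'M[K]_(nV G, nE G) := mpinv L.
Let d : 'cV[K]_(nV G) := degvec G K.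
Let g : 'cV[K]_(nV G) := X *m (X^T *m d).

(** The Penrose equations give [X = L^T *m X^T *m X], and the row of ones annihilates [L^T]. *)
Lemma one_mpinv_incidence : const_mx 1 *m X = 0 :> 'rV_(nE G).
Proof.
have [_ XLX _ sXL] := mpinvP L.
rewrite -/X in XLX sXL *; rewrite -XLX mulmxA -sXL trmx_mul mulmxA.
rewrite -[const_mx 1 *m _]trmxK trmx_mul trmxK trmx_const incidence_const.
by rewrite trmx0 !mul0mx.
Qed.

(** The left side reduces to [X *m L *m d], the projection of [d] orthogonal to the constants; the
    subtracted constant is the mean degree. *)
Lemma gram_incidence_mpinv :
  L^T *m L *m g = d - const_mx (2 * (nE G)%:R / (nV G)%:R).
Proof.
have [n0 _] := conn; have [LXL XLX sLX sXL] := mpinvP L.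
rewrite -/X in LXL XLX sLX sXL.
have -> : L^T *m L *m g = X *m L *m d.
  rewrite /g !mulmxA -(mulmxA L^T) -[in LHS]sLX -trmx_mul LXL.
  by rewrite -trmx_mul sXL.
have h : L *m (X *m L *m d - d) = 0 by rewrite mulmxBr !mulmxA LXL subrr.
have hc := incidence_ker_const (Ordinal n0) conn h.
set c := _ 0 in hc; rewrite -[LHS](subrK d) hc addrC; congr (_ + _).
(* Summing entries determines the constant, by [one_mpinv_incidence] and the handshake identity. *)
have : const_mx 1 *m (X *m L *m d - d) = const_mx (- 2 * (nE G)%:R) :> 'rV_1.
  rewrite mulmxBr !mulmxA one_mpinv_incidence !mul0mx sub0r.
  apply/matrixP => i j; rewrite !mxE mulNr -natrM -sum_deg; congr (- _).
  by apply: eq_bigr => k _; rewrite !mxE mul1r.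
rewrite hc => /matrixP/(_ 0 0); rewrite !mxE.
under eq_bigr do rewrite !mxE mul1r.
rewrite sumr_const card_ord => e.
apply/matrixP => i j; rewrite !mxE.
have nz : (nV G)%:R != 0 :> K by rewrite pnatr_eq0 -lt0n.
by rewrite -[LHS](mulfK nz) [c * _]mulr_natr e !mulNr.
Qed.

Lemma sum_mpinv : \sum_i g i 0 = 0.
Proof.
have /matrixP/(_ 0 0) : const_mx 1 *m g = 0 :> 'rV_1.
  by rewrite /g mulmxA one_mpinv_incidence mul0mx.
by rewrite !mxE; under eq_bigr do rewrite mxE mul1r.
Qed.

Lemma normsq_mpinv : \sum_i d i 0 * g i 0 = normsq (X^T *m d).
Proof.
rewrite normsqE trmx_mul trmxK -mulmxA -/g mxE.
by apply: eq_bigr => i _; rewrite [d^T _ _]mxE.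
Qed.

End Pseudoinverse.
End Edges.

(** * Zeta function *)

Local Notation tofrac := FracField.tofrac.

(** The prefactor base [1 - w^2 q^2] has a simple zero at [1/w], so it contributes its exponent,
    whatever the sign. *)
Lemma pole_order_zeta (G : sgraph) (K : numFieldType) (u : K) : u != 1 ->
  pole_order (zeta G u) (1 - u)^-1
  = (nE G)%:Z - (nV G)%:Z + (mup (1 - u)^-1 (\det (zeta_mx G u)))%:Z.
Proof.
move=> u1; have w0 : 1 - u != 0 by rewrite subr_eq0 eq_sym.
have := zeta_neq0 G u; rewrite /zeta; set w := 1 - u in w0 *.
set F := 1 - _; set d := \det _; rewrite mulf_eq0 negb_or invr_eq0 tofrac_eq0.
case/andP=> _ d0.
(* The second factor takes the value [-2w] at [1/w], nonzero in characteristic zero. *)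
have FE : F = ('X - w^-1%:P) * (- w *: (1 + w *: 'X)).
  rewrite /F -!mul_polyC rmorphN rmorphXn /= mulrDl.
  have e : w^-1%:P * w%:P = 1 :> {poly K} by rewrite -polyCM mulVf.
  by ring: e.
have F0 : F != 0.
  apply/eqP => /(congr1 (fun p => p.[0])) /eqP.
  by rewrite !hornerE /= ?expr0n /= ?mulr0 ?subr0 oner_eq0.
have mF k : mup w^-1 (F ^+ k) = k.
  rewrite FE exprMn mupMl ?mup_XsubCX ?eqxx // rootE horner_exp.
  rewrite !hornerE divff // expf_neq0 // mulf_neq0 ?oppr_eq0 //.
  by rewrite (pnatr_eq0 _ 2).
have [le|lt] := leqP (nV G) (nE G).
  have -> : tofrac F ^ (- ((nE G)%:Z - (nV G)%:Z)) * (tofrac d)^-1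
      = tofrac 1 / tofrac (F ^+ (nE G - nV G) * d).
    by rewrite subzn // -exprnN rmorphM rmorphXn rmorph1 invfM mul1r.
  rewrite pole_order_frac ?oner_eq0 ?mulf_neq0 ?expf_neq0 //.
  rewrite mupM ?expf_neq0 // mF [mup _ 1]mupNroot ?root1 ?subr0 //.
  by rewrite PoszD subzn.
have -> : tofrac F ^ (- ((nE G)%:Z - (nV G)%:Z)) * (tofrac d)^-1
    = tofrac (F ^+ (nV G - nE G)) / tofrac d.
  by rewrite opprB subzn ?(ltnW lt) // rmorphXn.
rewrite pole_order_frac ?expf_neq0 // mF -subzn ?(ltnW lt) //.
by rewrite opprB addrC.
Qed.

(** * The zeta determinant expanded at [1/w] *)

Section ZetaOrder.
Variables (K : numFieldType) (G : sgraph) (u : K).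
Hypothesis u1 : u != 1.
Let w := 1 - u.
Let Lap := laplacian G K.
Let d := degvec G K.
Let one : 'cV[K]_(nV G) := const_mx 1.
Let E : {poly K} := 'X - w^-1%:P.
Let B : 'M[K]_(nV G) := w *: (Lap + degmx G K - (w *+ 2)%:M).
Let C : 'M[K]_(nV G) := w ^+ 2 *: (degmx G K - w%:M).

Let w0 : w != 0. Proof. by rewrite subr_eq0 eq_sym. Qed.

(** After scaling by [w] the variable occurs only through [w 'X = 1 + w E]. *)
Lemma zeta_mx_expansion : w%:P *: zeta_mx G u =
  map_mx polyC Lap + E *: map_mx polyC B + E ^+ 2 *: map_mx polyC C.
Proof.
have XE : w%:P * 'X = 1 + w%:P * E.
  by rewrite /E mulrBr -polyCM divff // addrC subrK.
apply/matrixP => i j; rewrite !mxE -/w.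
move: (_%:R *+ _) (adj _ _)%:R => D A.
move: (w : K) E XE => v E' XE.
rewrite !rmorphM !rmorphB /= !rmorphD /= !rmorphN /= !rmorphMn /=.
move: (v%:P) D%:P A%:P XE => {}v D' A' XE.
have -> : v * ((i == j)%:R - 'X * A' + 'X^2 * (v * (D' - v *+ (i == j))))
  = v *+ (i == j) - (v * 'X) * A' + (v * 'X) ^+ 2 * (D' - v *+ (i == j)).
  by case: (i == j); rewrite ?mulr1n ?mulr0n; ring.
by rewrite XE; case: (i == j); rewrite ?mulr1n ?mulr0n; ring.
Qed.

Let detE : \det (w%:P *: zeta_mx G u) = (w ^+ nV G)%:P * \det (zeta_mx G u).
Proof. by rewrite detZ rmorphXn. Qed.

Let mup_detE :
  mup w^-1 (\det (w%:P *: zeta_mx G u)) = mup w^-1 (\det (zeta_mx G u)).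
Proof. by rewrite detE mupMr // rootC expf_neq0. Qed.

Lemma det_zeta_mx_neq0 : \det (zeta_mx G u) != 0.
Proof.
have := zeta_neq0 G u.
by rewrite mulf_eq0 negb_or invr_eq0 tofrac_eq0 => /andP[].
Qed.

Variable kap : K.
Hypothesis nV_gt0 : (0 < nV G)%N.
(** These Laplacian facts come from an ordered field, where sums of squares are definite; as
    hypotheses they can be transported to the complex numbers. *)
Hypothesis sum_degE : \sum_(j < nV G) (deg (vtx j))%:R = (2 * nE G)%:R :> K.
Hypothesis Lap1 : Lap *m one = 0.
Hypothesis kap0 : kap != 0.
Hypothesis adjLap : \adj Lap = const_mx kap.

Let degmx_one : degmx G K *m one = d.
Proof. by apply/matrixP => i j; rewrite mul_diag_mx !mxE mulr1. Qed.

Let scalar_one c : c%:M *m one = const_mx c.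
Proof. by rewrite mul_scalar_mx; apply/matrixP => i j; rewrite !mxE mulr1. Qed.

Let Bone : B *m one = w *: (d - const_mx (w *+ 2)).
Proof.
by rewrite /B -scalemxAl mulmxBl mulmxDl Lap1 add0r degmx_one scalar_one.
Qed.

Let sumBone : \sum_i (B *m one) i 0 = 2 * w * ((nE G)%:R - w * (nV G)%:R).
Proof.
rewrite Bone; under eq_bigr do rewrite !mxE.
rewrite -mulr_sumr sumrB sum_degE sumr_const card_ord natrM.
by rewrite -[_ *+ nV G]mulr_natr; ring.
Qed.

(** Up to the nonzero factor [2w], the right-hand quantity is the first-order sum of [sumBone]. *)
Let ustarE : (u == ustar G K) = ((nE G)%:R - w * (nV G)%:R == 0).
Proof.
have nz : (nV G)%:R != 0 :> K by rewrite pnatr_eq0 -lt0n.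
rewrite subr_eq0 /ustar -(can2_eq (divfK nz) (mulfK nz)) /w.
by rewrite -[in RHS](inj_eq (can_inj (subKr 1))) subKr eq_sym.
Qed.

Lemma mup_det_zeta_eq1 : u != ustar G K ->
  mup w^-1 (\det (zeta_mx G u)) = 1%N.
Proof.
rewrite ustarE => h; rewrite -mup_detE zeta_mx_expansion.
apply: (mup_det_perturb1 _ _ Lap1 adjLap kap0 nV_gt0).
by rewrite sumBone !mulf_neq0 ?pnatr_eq0.
Qed.

Lemma mup_det_zeta_gt1 : u = ustar G K ->
  (1 < mup w^-1 (\det (zeta_mx G u)))%N.
Proof.
move/eqP; rewrite ustarE => /eqP h; rewrite -mup_detE zeta_mx_expansion.
apply: (mup_det_perturb_gt1 Lap1 adjLap nV_gt0); last first.
  by rewrite sumBone h mulr0.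
rewrite -zeta_mx_expansion detE mulf_neq0 ?det_zeta_mx_neq0 //.
by rewrite ?polyC_eq0 ?expf_neq0.
Qed.

Lemma mup_det_zeta_eq2 (g : 'cV[K]_(nV G)) : u = ustar G K ->
  Lap *m g = d - const_mx (2 * (nE G)%:R / (nV G)%:R) ->
  \sum_i g i 0 = 0 -> \sum_i d i 0 * g i 0 != (nE G)%:R ->
  mup w^-1 (\det (zeta_mx G u)) = 2%N.
Proof.
move/eqP; rewrite ustarE subr_eq0 => /eqP h Lg g0 dg.
have nz : (nV G)%:R != 0 :> K by rewrite pnatr_eq0 -lt0n.
rewrite -mup_detE zeta_mx_expansion.
(* Now [w = n_E / n_V], so [B *m one] is [w] times the centred degree vector [Lap *m g]. *)
apply: (mup_det_perturb2 _ Lap1 adjLap kap0 nV_gt0 (g := w *: g)).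
  rewrite -scalemxAr Lg Bone h mulrA mulfK //.
  by rewrite mulr_natl.
have LapT : \sum_i (Lap *m g) i 0 = 0.
  have /matrixP/(_ 0 0) : one^T *m (Lap *m g) = 0.
    rewrite mulmxA -[one^T *m _]trmxK trmx_mul trmxK laplacian_tr Lap1.
    by rewrite trmx0 mul0mx.
  by rewrite !mxE; under eq_bigr do rewrite 2!mxE mul1r.
have CBE i : (C *m one - B *m (w *: g)) i 0
    = w ^+ 2 * (d i 0 - w - (Lap *m g) i 0 - d i 0 * g i 0 + w *+ 2 * g i 0).
  rewrite /C /B -!scalemxAl -scalemxAr mulmxBl degmx_one scalar_one.
  rewrite mulmxBl mulmxDl mul_scalar_mx mul_diag_mx.
  by move: (Lap *m g) => x; rewrite !mxE; ring.
rewrite (eq_bigr _ (fun i _ => CBE i)) -mulr_sumr mulf_neq0 ?expf_neq0 //.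
(* With [n_E = w n_V] the sum becomes [n_E] minus the sum of the [d i 0 * g i 0]. *)
rewrite big_split /= -mulr_sumr g0 mulr0 addr0 3!sumrB LapT subr0.
rewrite sumr_const card_ord.
rewrite [\sum_i d i 0](_ : _ = (2 * nE G)%:R); last first.
  by rewrite -sum_degE; apply: eq_bigr => i _; rewrite mxE.
rewrite -[w *+ nV G]mulr_natr -h natrM subr_eq0 eq_sym.
by rewrite (_ : 2 * _ - _ = (nE G)%:R) //; ring.
Qed.

End ZetaOrder.

(** * Pole orders over the complex numbers: non-trees, trees and the norm criterion *)

Theorem theorem4p20 (R : realType) (G : sgraph) (s t : {set G} -> G)
    (u : R[i]) :
  connected_graph G -> is_orientation s t -> u <> 1 ->
  [/\ ~ is_tree G ->
        (u <> ustar G R[i] ->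
           pole_of_order (zeta G u) (1 - u)^-1 ((nE G)%:Z - (nV G)%:Z + 1)) /\
        ((nE G)%:Z - (nV G)%:Z + 2 <= pole_order (zeta G u) (1 - u)^-1
           <-> u = ustar G R[i]),
      is_tree G ->
        (u <> ustar G R[i] -> ~ is_pole (zeta G u) (1 - u)^-1) /\
        (is_pole (zeta G u) (1 - u)^-1 <-> u = ustar G R[i])
    & normsq ((mpinv (incidence R s t))^T *m degvec G R) <> (nE G)%:R ->
      u = ustar G R[i] ->
        pole_of_order (zeta G u) (1 - u)^-1 ((nE G)%:Z - (nV G)%:Z + 2)].
Proof.
move=> conn st /eqP u1; have [n0 _] := conn.
(* Rank and positivity arguments run over [R]; their conclusions are carried to [R[i]] along this
   embedding. *)
pose toC : {rmorphism R -> R[i]} := real_complex R.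
have rankL := rank_incidence st R conn.
have treeE : is_tree G <-> nE G = (nV G).-1.
  rewrite -rankL /=; split=> [[_ /(acyclic_row_free st R)/eqP]|e] //.
  by split=> //; apply: (@row_free_acyclic _ s t st R); rewrite /row_free -e.
have le_rank : ((nV G).-1 <= nE G)%N by rewrite -rankL /= rank_leq_row.
have {}n0 : (0 < nV G)%N by [].
have Lap1 : laplacian G R *m const_mx 1 = 0 :> 'cV_(nV G).
  by rewrite -(gram_incidence st) -mulmxA incidence_const ?mulmx0.
have Lap1C : laplacian G R[i] *m const_mx 1 = 0 :> 'cV_(nV G).
  rewrite -(map_laplacian G toC) -(rmorph1 toC) -map_const_mx -map_mxM Lap1.
  by rewrite map_mx0.
have [kap kap0 adjL] := adj_gram_incidence st R conn.
have adjC : \adj (laplacian G R[i]) = const_mx (toC kap).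
  rewrite -(map_laplacian G toC) -map_mx_adj -(gram_incidence st) adjL.
  by rewrite map_const_mx.
have kapC : toC kap != 0 by rewrite fmorph_eq0.
have sumC : \sum_(j < nV G) (deg (vtx j))%:R = (2 * nE G)%:R :> R[i].
  rewrite -(rmorph_nat toC) -(sum_deg st) rmorph_sum.
  by apply: eq_bigr => j _; rewrite /= rmorph_nat.
have mup1 := mup_det_zeta_eq1 u1 n0 sumC Lap1C kapC adjC.
have mup2 := mup_det_zeta_gt1 u1 n0 sumC Lap1C adjC.
have mup3 := mup_det_zeta_eq2 u1 n0 sumC Lap1C kapC adjC.
rewrite /pole_of_order /is_pole (pole_order_zeta G u1).
split=> [ntree|tree|nd uE].
- have neq : nE G <> (nV G).-1 by move=> /treeE.
  (* Hence [n_E - n_V + 1] is positive and the point is a genuine pole. *)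
  have m_ge : (nV G <= nE G)%N by lia.
  split; first by move=> /eqP/mup1->; lia.
  by split=> [|/mup2]; [case: (eqVneq u (ustar G R[i])) => // /mup1->|]; lia.
(* The prefactor lowers the order by one, so a simple zero of the determinant gives no pole and a
   higher one does. *)
- have mE := treeE.1 tree.
  split; first by move=> /eqP/mup1->; lia.
  by split=> [|/mup2]; [case: (eqVneq u (ustar G R[i])) => // /mup1->|]; lia.
pose X := mpinv (incidence R s t).
(* The corrector is the real vector [g], read over [R[i]]. *)
rewrite (mup3 (map_mx toC (X *m (X^T *m degvec G R)))) ?uE //; first lia.
- rewrite -(map_laplacian G toC) -map_mxM -(gram_incidence st).
  rewrite (gram_incidence_mpinv st R conn) map_mxB map_degvec map_const_mx.
  have <- : toC (2 * (nE G)%:R / (nV G)%:R) = 2 * (nE G)%:R / (nV G)%:R.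
    by rewrite !rmorphM fmorphV !rmorph_nat.
  by [].
- under eq_bigr do rewrite mxE.
  by rewrite -rmorph_sum (sum_mpinv st) rmorph0.
- under eq_bigr => i _ do
    rewrite -(map_degvec G toC) [X in X * _]mxE [X in _ * X]mxE -rmorphM.
  rewrite -rmorph_sum normsq_mpinv -(rmorph_nat toC) (inj_eq (fmorph_inj _)).
  exact/eqP.
Qed.
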